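(* Let $I$ be a non-empty set and let $E\subseteq\mathbb{R}^I$ be a linear subspace containing all $e_i$ ($i\in I$), endowed with a complete absolute normalised norm $\|\cdot\|_E$ such that $\operatorname{span}\{e_i:i\in I\}$ is dense in $E$. If $(X_i)_{i\in I}$ is a family of sluacs (resp. luacs) Banach spaces and $E$ is sluacs (resp. luacs) and has the property $(P)$, then $\bigl[\bigoplus_{i\in I}X_i\bigr]_E$ is sluacs (resp. luacs) as well.
   Context: Banach spaces are real; $S_X$ denotes the unit sphere of $X$ and $X^*$ its dual. A Banach space $X$ is called - luacs if for every $x\in S_X$, every sequence $(x_n)$ in $S_X$ and every $x^*\in S_{X^*}$: $\|x_n+x\|\to 2$ and $x^*(x_n)\to 1$ imply $x^*(x)=1$; - sluacs if for every $x\in S_X$ and all sequences $(x_n)$ in $S_X$ and $(x_n^* )$ in $S_{X^*}$: $\|x_n+x\|\to 2$ and $x_n^*(x_n)\to 1$ imply $x_n^*(x)\to 1$. For a non-empty set $I$, $e_i\in\mathbb{R}^I$ denotes the characteristic function of $\{i\}$. A norm $\|\cdot\|_E$ on a subspace $E$ of $\mathbb{R}^I$ (with all $e_i\in E$) is absolute if whenever $(a_i)_{i\in I}\in E$, $(b_i)_{i\in I}\in\mathbb{R}^I$ and $|a_i|=|b_i|$ for all $i\in I$, then $(b_i)_{i\in I}\in E$ and $\|(a_i)_{i\in I}\|_E=\|(b_i)_{i\in I}\|_E$; it is normalised if $\|e_i\|_E=1$ for every $i\in I$. $E$ has the property $(P)$ if for every sequence $(a_n)$ in $S_E$ and every $a\in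 S_E$, $\|a_n+a\|_E\to 2$ implies $a_n\to a$ pointwise on $I$. For a family $(X_i)_{i\in I}$ of Banach spaces, the absolute sum with respect to $E$ is $\bigl[\bigoplus_{i\in I}X_i\bigr]_E=\{(x_i)_{i\in I}\in\prod_{i\in I}X_i:(\|x_i\|)_{i\in I}\in E\}$ with the norm $\|(x_i)_{i\in I}\|_E=\|(\|x_i\|)_{i\in I}\|_E$; it is a Banach space. *)

(* Defs.v *)
From HB Require Import structures.
From mathcomp Require Import all_boot all_order all_algebra.
From mathcomp Require Import all_classical all_reals all_analysis.
From mathcomp Require Import ring lra.

Set Implicit Arguments.
Unset Strict Implicit.
Unset Printing Implicit Defensive.

Import Order.TTheory GRing.Theory Num.Theory.
Import numFieldNormedType.Exports.
Local Open Scope classical_set_scope.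
Local Open Scope ring_scope.

Section acs.
Context {R : realType}.

Definition unit_sphere (X : normedModType R) : set X := [set x | `|x| = 1].

Definition dual_norm (X : normedModType R) (f : {linear X -> R}) : R :=
  sup [set `|f x| | x in [set x : X | `|x| <= 1]].

(* [sup] is meaningless on unbounded sets, hence the explicit continuity. *)
Definition dual_unit_sphere (X : normedModType R) : set {linear X -> R} :=
  [set f : {linear X -> R} | continuous f /\ dual_norm f = 1].

(* luacs: locally uniformly alternatively convex or smooth. *)
Definition luacs (X : completeNormedModType R) : Prop :=
  forall (x : X) (x_ : nat -> X) (f : {linear X -> R}),
    unit_sphere x -> (forall n, unit_sphere (x_ n)) ->
    dual_unit_sphere f ->
    `|x_ n + x| @[n --> \oo] --> (2 : R) ->
    f (x_ n) @[n --> \oo] --> (1 : R) ->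
    f x = 1.

(* sluacs: strongly locally uniformly alternatively convex or smooth. *)
Definition sluacs (X : completeNormedModType R) : Prop :=
  forall (x : X) (x_ : nat -> X) (f_ : nat -> {linear X -> R}),
    unit_sphere x -> (forall n, unit_sphere (x_ n)) ->
    (forall n, dual_unit_sphere (f_ n)) ->
    `|x_ n + x| @[n --> \oo] --> (2 : R) ->
    f_ n (x_ n) @[n --> \oo] --> (1 : R) ->
    f_ n x @[n --> \oo] --> (1 : R).

End acs.

(* A linear subspace E of R^I containing all e_i = \1_[set i], with a complete
   absolute normalised norm. The values of [as_norm] outside of [as_set] are
   irrelevant. *)
Record absolute_space (R : realType) (I : Type) := AbsoluteSpace {
  as_set : set (I -> R) ;
  as_norm : (I -> R) -> R ;
  as_set0 : as_set 0 ;
  as_setP : forall (k : R) (a b : I -> R),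
    as_set a -> as_set b -> as_set (k *: a + b) ;
  as_set_e : forall i, as_set \1_[set i] ;
  as_normD : forall a b : I -> R, as_set a -> as_set b ->
    as_norm (a + b) <= as_norm a + as_norm b ;
  as_normZ : forall (k : R) (a : I -> R), as_set a ->
    as_norm (k *: a) = `|k| * as_norm a ;
  as_norm0_eq0 : forall a, as_set a -> as_norm a = 0 -> a = 0 ;
  as_complete : forall u : nat -> I -> R, (forall n, as_set (u n)) ->
    (forall e : R, 0 < e -> exists N, forall m n, (N <= m)%N -> (N <= n)%N ->
      as_norm (u m - u n) < e) ->
    exists2 a, as_set a & as_norm (u n - a) @[n --> \oo] --> (0 : R) ;
  as_absolute : forall a b : I -> R, as_set a ->
    (forall i, `|a i| = `|b i|) -> as_set b /\ as_norm a = as_norm b ;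
  as_normalised : forall i, as_norm \1_[set i] = 1
}.

Lemma seq_complete_cauchy_cvg (R : realType) (V : normedModType R) :
  (forall u : nat -> V,
    (forall e : R, 0 < e -> exists N, forall m n, (N <= m)%N -> (N <= n)%N ->
      `|u m - u n| < e) -> exists l, `|u n - l| @[n --> \oo] --> (0 : R)) ->
  forall F : set_system V, ProperFilter F -> cauchy F -> cvg F.
Proof.
move=> Vc F FF /cauchyP Fc.
have /choice[u uP] : forall n : nat, exists x, F (ball x (n.+1%:R^-1 : R)).
  by move=> n; apply: Fc; rewrite invr_gt0.
have inve (e : R) : 0 < e -> exists N, forall n, (N <= n)%N -> n.+1%:R^-1 < e.
  move=> e0; have /cvgrPdist_lt/(_ e e0)[N _ NP] := @cvg_harmonic R.
  exists N => n Nn; have := NP n Nn.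
  by rewrite /= sub0r normrN ger0_norm.
have [] := Vc u.
  move=> e e0; have [N NP] := inve (e / 2) (divr_gt0 e0 (ltr0Sn _ _)).
  exists N => m n Nm Nn.
  have [z []] := filter_ex (filterI (uP m) (uP n)).
  rewrite -!ball_normE /= => um un.
  have -> : u m - u n = (u m - z) - (u n - z) by rewrite opprB addrA subrK.
  rewrite (le_lt_trans (ler_normB _ _))// (splitr e) ltrD//.
    exact: lt_trans um (NP m Nm).
  exact: lt_trans un (NP n Nn).
move=> l /cvgrPdist_lt ul; apply/cvg_ex; exists l; apply/cvgrPdist_lt => e e0.
have e20 : 0 < e / 2 by rewrite divr_gt0.
have [N NP] := inve _ e20; have [M _ MP] := ul _ e20.
have := uP (maxn N M); apply: filterS => z; rewrite -ball_normE /= => uz.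
have := MP (maxn N M) (leq_maxr _ _); rewrite /= sub0r normrN normr_id => ul'.
have -> : l - z = (u (maxn N M) - z) - (u (maxn N M) - l).
  by rewrite opprB [RHS]addrC addrA subrK.
rewrite (le_lt_trans (ler_normB _ _))// (splitr e) ltrD//.
exact: lt_trans uz (NP _ (leq_maxl _ _)).
Qed.

Lemma seq_cauchy_cvg (R : realType) (V : completeNormedModType R) (u : nat -> V) :
  (forall e : R, 0 < e -> exists N, forall m n, (N <= m)%N -> (N <= n)%N ->
    `|u m - u n| < e) -> cvg (u @ \oo).
Proof.
move=> uc; apply: cauchy_cvg; apply/cauchyP => e /uc[N NP]; exists (u N).
by exists N => // n /= Nn; rewrite -ball_normE /=; exact: NP.
Qed.

Section absolute_space_type.
Context {R : realType} {I : Type} (E : absolute_space R I).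

Definition as_mem : {pred I -> R} := fun a => a \in as_set E.

Lemma as_memP a : reflect (as_set E a) (a \in as_mem).
Proof. by apply: (iffP idP) => [/set_mem|/mem_set]. Qed.

Lemma as_submod_closed : submod_closed as_mem.
Proof.
split; first by apply/as_memP; exact: as_set0.
by move=> k a b /as_memP Ea /as_memP Eb; apply/as_memP; exact: as_setP.
Qed.

HB.instance Definition _ :=
  GRing.isSubmodClosed.Build R (I -> R) as_mem as_submod_closed.

Record as_type := AsType { as_val :> I -> R ; _ : as_val \in as_mem }.

HB.instance Definition _ := [isSub for as_val].
HB.instance Definition _ := [Choice of as_type by <:].
HB.instance Definition _ := [SubChoice_isSubLmodule of as_type by <:].


Lemma as_valP (a : as_type) : as_set E a.
Proof. by case: a => a /= /as_memP. Qed.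

Lemma as_type_normD (a b : as_type) :
  as_norm E (a + b : as_type) <= as_norm E a + as_norm E b.
Proof. by apply: as_normD; exact: as_valP. Qed.

Lemma as_type_normZ (k : R) (a : as_type) :
  as_norm E (k *: a : as_type) = `|k| * as_norm E a.
Proof. by apply: as_normZ; exact: as_valP. Qed.

Lemma as_type_norm0_eq0 (a : as_type) : as_norm E a = 0 -> a = 0.
Proof. by move=> a0; apply/val_inj; exact: (as_norm0_eq0 (as_valP a) a0). Qed.

HB.instance Definition _ := Lmodule_isNormed.Build R as_type
  as_type_normD as_type_normZ as_type_norm0_eq0.

Lemma as_normE (a : as_type) : `|a| = as_norm E a.
Proof. by []. Qed.

Lemma as_type_complete :
  forall F : set_system as_type, ProperFilter F -> cauchy F -> cvg F.
Proof.
apply: seq_complete_cauchy_cvg => u uc.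
have [n|//|a Ea ua] := @as_complete _ _ E (fun n => u n : I -> R).
  exact: as_valP.
by have /as_memP Ea' := Ea; exists (AsType Ea').
Qed.

HB.instance Definition _ := Uniform_isComplete.Build as_type as_type_complete.

Lemma as_coord_le (a : as_type) i : `|a i| <= `|a|.
Proof.
pose b := fun j : I => if pselect (j = i) then a j else - a j.
have [Eb nab] : as_set E b /\ as_norm E a = as_norm E b.
  apply: as_absolute; first exact: as_valP.
  by move=> j; rewrite /b; case: pselect => //= _; rewrite normrN.
have := as_normD (as_valP a) Eb.
have -> : (a : I -> R) + b = (a i *+ 2) *: \1_[set i].
  apply/funext => j; rewrite /GRing.scale /GRing.add /= /b indicE [RHS]/=.
  case: pselect => /= [->|ji]; first by rewrite mem_set// scaler1 mulr2n.
  by rewrite memNset// scaler0 subrr.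
rewrite as_normZ ?as_normalised; last exact: as_set_e.
rewrite mulr1 -nab -as_normE normrMn -mulr2n lerMn2r /=.
by [].
Qed.

Lemma as_coord_cvg (u : nat -> as_type) (a : as_type) i :
  u n @[n --> \oo] --> a -> u n i @[n --> \oo] --> a i.
Proof.
move=> /cvgrPdist_lt ua; apply/cvgrPdist_lt => e /ua; apply: filterS => n.
exact: (le_lt_trans (as_coord_le (a - u n) i)).
Qed.

(* This uses completeness; it is what makes the absolute sum a vector space. *)
Lemma as_solid (a b : I -> R) : as_set E a -> (forall i, `|b i| <= `|a i|) ->
  as_set E b /\ as_norm E b <= as_norm E a.
Proof.
move=> Ea ba.
(* binary expansion of b in terms of +/- |a| *)
pose c (r : I -> R) : I -> R := fun i => if 0 <= r i then `|a i| else - `|a i|.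
pose r := fix r n := if n is n'.+1 then 2 *: r n' - c (r n') else b.
have rS n i : r n.+1 i = 2 * r n i - c (r n) i by [].
have rP n i : `|r n i| <= `|a i|.
  elim: n i => [|n IH] i; first exact: ba.
  rewrite rS /c; have := IH i.
  by case: (leP 0 (r n i)) => r0; rewrite ?(ger0_norm r0) ?(ltr0_norm r0)
    ler_norml => ra; apply/andP; split; lra.
have cP n : as_set E (c (r n)) /\ as_norm E a = as_norm E (c (r n)).
  apply: as_absolute => // i; rewrite /c; case: ifP => _; last rewrite normrN;
  by rewrite normr_id.
have cT n : c (r n) \in as_mem by apply/as_memP; case: (cP n).
pose p : nat -> as_type := fun n =>
  \sum_(k < n) (2^-1 ^+ k.+1) *: (AsType (cT k) : as_type).
have pS n : p n.+1 = p n + (2^-1 ^+ n.+1) *: AsType (cT n).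
  by rewrite /p big_ord_recr.
have pr n i : b i - p n i = 2^-1 ^+ n * r n i.
  elim: n => [|n IH]; first by rewrite /p big_ord0 subr0 expr0 mul1r.
  have -> : p n.+1 i = p n i + 2^-1 ^+ n.+1 * c (r n) i by rewrite pS.
  by rewrite opprD addrA IH rS exprS; field.
have pn n m : `|p (n + m)%N - p n| <= (2^-1 ^+ n - 2^-1 ^+ (n + m)) * as_norm E a.
  elim: m => [|m IH]; first by rewrite addn0 !subrr normr0 mul0r.
  rewrite addnS pS addrAC (le_trans (ler_normD _ _))//.
  rewrite normrZ [X in _ + _ * X]as_normE /= -(cP (n + m)%N).2.
  rewrite ger0_norm ?exprn_ge0 ?invr_ge0//.
  by rewrite (le_trans (lerD IH (lexx _)))// exprS; lra.
have Na0 : 0 <= as_norm E a.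
  by have /as_memP Ea' := Ea; exact: (normr_ge0 (AsType Ea' : as_type)).
have half (e : R) : 0 < e -> exists N, forall n, (N <= n)%N ->
    2^-1 ^+ n * as_norm E a < e.
  move=> e0; have : 2^-1 ^+ n * as_norm E a @[n --> \oo] --> 0 * as_norm E a.
    by apply: cvgM; [apply: cvg_expr; rewrite ger0_norm; lra|exact: cvg_cst].
  rewrite mul0r => /cvgrPdist_lt/(_ e e0)[N _ NP]; exists N => n /NP /=.
  by rewrite sub0r normrN ger0_norm// mulr_ge0// exprn_ge0// invr_ge0.
have [l pl] : exists l : as_type, p n @[n --> \oo] --> l.
  apply/cvg_ex/seq_cauchy_cvg => e /half[N NP]; exists N => m n Nm Nn.
  wlog nm : m n Nm Nn / (n <= m)%N.
    move=> H; have [/H|/ltnW/H] := leqP n m; first exact.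
    by rewrite distrC; exact.
  rewrite -(subnKC nm) (le_lt_trans (pn _ _))// (le_lt_trans _ (NP n Nn))//.
  by rewrite ler_wpM2r// gerBl exprn_ge0// invr_ge0.
have lb : b = l.
  apply/funext => i.
  have li := @as_coord_cvg p l i pl.
  suff bi : p n i @[n --> \oo] --> b i by exact: (cvg_unique _ bi li).
  apply/cvgrPdist_lt => e /half[N NP]; exists N => // n /= /NP; rewrite pr.
  apply: le_lt_trans; rewrite normrM ger0_norm ?exprn_ge0 ?invr_ge0//.
  rewrite ler_wpM2l ?exprn_ge0 ?invr_ge0// (le_trans (rP n i))//.
  by have /as_memP Ea' := Ea; exact: (as_coord_le (AsType Ea') i).
rewrite lb; split; first exact: as_valP.
rewrite -as_normE.
apply/ler_addgt0Pr => e e0.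
have /cvgrPdist_lt/(_ e e0)[N _ NP] := pl.
have := NP N (leqnn N) => /= lp.
rewrite -(subrK (p N) l) addrC (le_trans (ler_normD _ _))//.
rewrite lerD ?(ltW lp)//.
have := pn 0%N N; rewrite add0n {2}/p big_ord0 subr0 => /le_trans; apply.
by rewrite -[leRHS]mul1r ler_wpM2r// expr0 gerBl exprn_ge0// invr_ge0.
Qed.

End absolute_space_type.

Coercion as_type : absolute_space >-> Sortclass.

Definition as_unit (R : realType) (I : Type) (E : absolute_space R I) (i : I) : E :=
  AsType (introT (as_memP E _) (as_set_e E i)).

Definition finite_span (R : realType) (I : Type) (E : absolute_space R I) : set E :=
  [set a : E | exists (s : seq I) (c : I -> R), a = \sum_(i <- s) c i *: as_unit E i].
Arguments finite_span {R I} E.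

Definition property_P (R : realType) (I : Type) (E : absolute_space R I) : Prop :=
  forall (a_ : nat -> E) (a : E),
    (forall n, unit_sphere (a_ n)) -> unit_sphere a ->
    `|a_ n + a| @[n --> \oo] --> (2 : R) ->
    forall i, a_ n i @[n --> \oo] --> a i.

Section absolute_sum.
Context {R : realType} {I : Type} (E : absolute_space R I).
Variable X : I -> completeNormedModType R.

Record absolute_sum := AbsoluteSum {
  sum_val :> forall i, X i ;
  sum_valP : as_set E (fun i => `|sum_val i|)
}.

HB.instance Definition _ := gen_eqMixin absolute_sum.
HB.instance Definition _ := gen_choiceMixin absolute_sum.

Lemma absolute_sum_eq (x y : absolute_sum) : (forall i, x i = y i) -> x = y.
Proof.
case: x y => [x xP] [y yP] /= xy; have {}xy : x = y by exact: functional_extensionality_dep.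
by rewrite -xy in yP *; congr AbsoluteSum; exact: Prop_irrelevance.
Qed.

Lemma sum_zeroP : as_set E (fun i => `|0 : X i|).
Proof.
by rewrite (_ : (fun i => _) = 0) ?funeqE; [exact: as_set0|move=> i; rewrite normr0].
Qed.

Lemma sum_oppP (x : absolute_sum) : as_set E (fun i => `|- x i|).
Proof.
rewrite (_ : (fun i => _) = fun i => `|x i|); first exact: sum_valP.
by apply/funext => i; rewrite normrN.
Qed.

Lemma as_setD (a b : I -> R) : as_set E a -> as_set E b -> as_set E (a + b).
Proof. by move=> Ea Eb; rewrite -[a]scale1r; exact: as_setP. Qed.

Lemma as_setZ (k : R) (a : I -> R) : as_set E a -> as_set E (k *: a).
Proof. by move=> Ea; rewrite -[k *: a]addr0; apply: as_setP => //; exact: as_set0. Qed.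

Lemma sum_add_solid (x y : absolute_sum) :
  as_set E (fun i => `|x i + y i|) /\
  as_norm E (fun i => `|x i + y i|) <=
  as_norm E ((fun i => `|x i|) + (fun i => `|y i|)).
Proof.
apply: as_solid; first by apply: as_setD; exact: sum_valP.
move=> i; rewrite normr_id (le_trans (ler_normD _ _))//.
by rewrite [leRHS]ger0_norm ?addr_ge0.
Qed.

Lemma sum_scaleE (k : R) (x : absolute_sum) :
  (fun i => `|k *: x i|) = `|k| *: (fun i => `|x i|).
Proof. by apply/funext => i; rewrite normrZ. Qed.

Lemma sum_scaleP (k : R) (x : absolute_sum) : as_set E (fun i => `|k *: x i|).
Proof. by rewrite sum_scaleE; apply: as_setZ; exact: sum_valP. Qed.

Definition sum_zero := AbsoluteSum sum_zeroP.
Definition sum_opp x := AbsoluteSum (sum_oppP x).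
Definition sum_add x y := AbsoluteSum (sum_add_solid x y).1.
Definition sum_scale k x := AbsoluteSum (sum_scaleP k x).

Lemma sum_addA : associative sum_add.
Proof. by move=> x y z; apply: absolute_sum_eq => i /=; rewrite addrA. Qed.
Lemma sum_addC : commutative sum_add.
Proof. by move=> x y; apply: absolute_sum_eq => i /=; rewrite addrC. Qed.
Lemma sum_add0 : left_id sum_zero sum_add.
Proof. by move=> x; apply: absolute_sum_eq => i /=; rewrite add0r. Qed.
Lemma sum_addN : left_inverse sum_zero sum_opp sum_add.
Proof. by move=> x; apply: absolute_sum_eq => i /=; rewrite addNr. Qed.

HB.instance Definition _ :=
  GRing.isZmodule.Build absolute_sum sum_addA sum_addC sum_add0 sum_addN.

Lemma sum_scaleA k l x : sum_scale k (sum_scale l x) = sum_scale (k * l) x.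
Proof. by apply: absolute_sum_eq => i /=; rewrite scalerA. Qed.
Lemma sum_scale1 : left_id 1 sum_scale.
Proof. by move=> x; apply: absolute_sum_eq => i /=; rewrite scale1r. Qed.
Lemma sum_scaleDr : right_distributive sum_scale +%R.
Proof. by move=> k x y; apply: absolute_sum_eq => i /=; rewrite scalerDr. Qed.
Lemma sum_scaleDl x : {morph sum_scale^~ x : k l / k + l}.
Proof. by move=> k l; apply: absolute_sum_eq => i /=; rewrite scalerDl. Qed.

HB.instance Definition _ := GRing.Zmodule_isLmodule.Build R absolute_sum
  sum_scaleA sum_scale1 sum_scaleDr sum_scaleDl.

Definition sum_norm (x : absolute_sum) : R := as_norm E (fun i => `|x i|).

Lemma sum_normD x y : sum_norm (x + y) <= sum_norm x + sum_norm y.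
Proof.
rewrite (le_trans (sum_add_solid x y).2)//.
by apply: as_normD; exact: sum_valP.
Qed.

Lemma sum_normZ k x : sum_norm (k *: x) = `|k| * sum_norm x.
Proof.
rewrite /sum_norm [X in as_norm E X](sum_scaleE k x) as_normZ ?normr_id//.
exact: sum_valP.
Qed.

Lemma sum_norm0_eq0 x : sum_norm x = 0 -> x = 0.
Proof.
move=> /(as_norm0_eq0 (sum_valP x)) x0; apply: absolute_sum_eq => i.
by apply/eqP; rewrite -normr_eq0; apply/eqP; exact: (congr1 (@^~ i) x0).
Qed.

HB.instance Definition _ := Lmodule_isNormed.Build R absolute_sum
  sum_normD sum_normZ sum_norm0_eq0.

Lemma sum_normE (x : absolute_sum) : `|x| = as_norm E (fun i => `|x i|).
Proof. by []. Qed.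

Let nE (x : absolute_sum) : E := AsType (introT (as_memP E _) (sum_valP x)).

Lemma sum_coord_le (x : absolute_sum) i : `|x i| <= `|x|.
Proof. by rewrite -[leLHS]normr_id; exact: (as_coord_le (nE x) i). Qed.

Lemma absolute_sum_complete :
  forall F : set_system absolute_sum, ProperFilter F -> cauchy F -> cvg F.
Proof.
apply: seq_complete_cauchy_cvg => u uc.
have uicvg i : cvg (u n i @[n --> \oo]).
  apply: seq_cauchy_cvg => e /uc[N NP]; exists N => m n Nm Nn.
  exact: le_lt_trans (sum_coord_le (u m - u n) i) (NP m n Nm Nn).
pose y i : X i := lim (u n i @[n --> \oo]).
have uy i : u n i @[n --> \oo] --> y i by exact: uicvg.
have H n : exists2 b : E, (b : I -> R) = (fun i => `|u n i - y i|) &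
    nE (u n - u m) @[m --> \oo] --> b.
  have [b ub] : exists b : E, nE (u n - u m) @[m --> \oo] --> b.
    apply/cvg_ex/seq_cauchy_cvg => e /uc[N NP]; exists N => m k Nm Nk.
    apply: le_lt_trans (NP m k Nm Nk).
    rewrite distrC.
    apply: (as_solid (sum_valP (u m - u k)) _).2 => i.
    rewrite normr_id; apply: (le_trans (ler_dist_dist _ _)).
    rewrite /=.
    suff -> : u n i - u k i - (u n i - u m i) = u m i - u k i by [].
    by rewrite opprB addrC addrA subrK.
  exists b => //; apply/funext => i.
  have bi := as_coord_cvg (i := i) ub.
  have bi' : nE (u n - u m) i @[m --> \oo] --> `|u n i - y i|.
    exact: (cvg_norm (cvgB (cvg_cst (u n i)) (uy i))).
  exact: (cvg_unique _ bi bi').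
have yP : as_set E (fun i => `|y i|).
  have [b bE _] := H 0%N.
  apply: (as_solid (as_setD (sum_valP (u 0%N)) (as_valP b)) _).1 => i.
  rewrite normr_id bE [leRHS]ger0_norm ?addr_ge0//.
  have {1}-> : y i = u 0%N i - (u 0%N i - y i) by rewrite subKr.
  exact: ler_normB.
exists (AbsoluteSum yP); apply/cvgrPdist_le => e e0.
have [N NP] := uc _ (divr_gt0 e0 (ltr0Sn _ 1)).
exists N => // n /= Nn; rewrite sub0r normrN normr_id.
have [b bE] := H n => /cvgrPdist_lt/(_ _ (divr_gt0 e0 (ltr0Sn _ 1)))[M _ MP].
have -> : `|u n - AbsoluteSum yP| = `|b|.
  by rewrite as_normE bE.
have := MP (maxn N M) (leq_maxr _ _) => /= bm.
rewrite -(subrK (nE (u n - u (maxn N M))) b) (le_trans (ler_normD _ _))//.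
rewrite (splitr e) lerD// ?(ltW bm)//.
exact: ltW (NP n (maxn N M) Nn (leq_maxl _ _)).
Qed.

HB.instance Definition _ :=
  Uniform_isComplete.Build absolute_sum absolute_sum_complete.

End absolute_sum.

(* Main.v *)
Require Import Defs.
From HB Require Import structures.
From mathcomp Require Import all_boot all_order all_algebra.
From mathcomp Require Import all_classical all_reals all_analysis.
From mathcomp Require Import ring lra.

(** Write Y for the absolute sum, x, x_n for the vectors and f_n for the
functionals on Y. The idea is to transport the hypotheses on Y to E and to
each X_i, and to glue the conclusions back together.

Transport to E. To a continuous functional f on Y corresponds its modulus,
the functional sending a nonnegative b in E to the supremum of f over the
vectors y with |y_i| <= b_i for all i. By a Riesz decomposition argument it is
additive on the positive cone, so it extends to a linear functional on E,
which has the same norm as f ([modulus_linear]). It plays the role of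
b |-> sum_i |f_i| b_i, where f_i is the restriction of f to the i-th summand,
and avoids summing over I. The norms (|x_n i|)_i
and (|x i|)_i are unit vectors a_n, a of E with |a_n + a| -> 2, and the moduli
phi_n of the f_n satisfy phi_n a_n -> 1. The hypothesis on E gives
phi_n a -> 1, and it remains to see that the gap phi_n a - f_n x, which is
nonnegative, tends to 0.

Transport to X_i. The gap phi_n (|y_i|)_i - f_n y is subadditive in y, is
additive over disjoint supports and is at most 2 |y|. It tends to 0 along
y = x_n, hence also along each single coordinate of x_n. Property (P) gives
|x_n i| -> |x i|, and property (P) applied to a second vector, a with its i-th
coordinate slightly lowered, forces |x_n i + x i| -> 2 |x i|
([coord_sum_near]). So the hypothesis on X_i applies to the normalised
coordinates and shows that the gap at the i-th coordinate of x tends to 0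
([acs_at_scaled]).

Gluing. As finitely supported vectors are dense in E, x is up to a small error
the sum of finitely many of its coordinates ([dense_restrict]), and
subadditivity of the gap concludes ([sum_acs_seq]).

Both properties are handled at once by an epsilon-delta condition [acs_at K x]
relative to a set K of functionals: sluacs gives it for every K contained in
the dual sphere, luacs for every such K with at most one element. The
epsilon-delta form also avoids extracting subsequences. *)

Set Implicit Arguments.
Unset Strict Implicit.
Unset Printing Implicit Defensive.

Import Order.TTheory GRing.Theory Num.Theory.
Import numFieldNormedType.Exports.
Local Open Scope classical_set_scope.
Local Open Scope ring_scope.

(** * The dual norm *)

Section dual_norm_theory.
Context {R : realType} {X : normedModType R}.
Implicit Types (f g : {linear X -> R}) (x : X) (c : R).

Lemma dual_norm_le f c : 0 <= c -> (forall x, `|x| <= 1 -> `|f x| <= c) ->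
  dual_norm f <= c.
Proof.
move=> c0 fc; apply: ge_sup; last by move=> _ /= [x x1 <-]; exact: fc.
by exists `|f 0|, 0 => //=; rewrite normr0.
Qed.

Lemma dual_norm_ub f x : continuous f -> `|x| <= 1 -> `|f x| <= dual_norm f.
Proof.
move=> fc x1; apply: ub_le_sup; last by exists x.
have [M fM] := (bounded_funP f).2 ((linear_bounded_continuous f).2 fc) 1.
by exists M => _ /= [y y1 <-]; exact: fM.
Qed.

Lemma dual_norm_ge0 f : continuous f -> 0 <= dual_norm f.
Proof.
by move=> fc; rewrite (le_trans (normr_ge0 (f 0)))// dual_norm_ub// normr0.
Qed.

Lemma ler_dual_norm f x : continuous f -> `|f x| <= dual_norm f * `|x|.
Proof.
move=> fc; have [->|x0] := eqVneq x 0.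
  by rewrite linear0 !normr0 mulr0.
have nx0 : 0 < `|x| by rewrite normr_gt0.
rewrite -ler_pdivrMr// mulrC -[X in X * _]ger0_norm ?invr_ge0// -normrM.
have -> : `|x|^-1 * f x = f (`|x|^-1 *: x) by rewrite linearZ.
by apply: dual_norm_ub => //; rewrite normrZ normfV normr_id mulVf// gt_eqF.
Qed.

Lemma bounded_continuous f c : (forall x, `|f x| <= c * `|x|) -> continuous f.
Proof.
move=> fc; apply/linear_bounded_continuous/linear_boundedP.
near=> r => x; rewrite (le_trans (fc x))// ler_wpM2r//.
Unshelve. end_near. Qed.

Definition normalized g : {linear X -> R} := (dual_norm g)^-1 \*: g.

Lemma normalizedE g x : normalized g x = (dual_norm g)^-1 * g x.
Proof. by []. Qed.

Lemma dual_unit_sphere_normalized g : continuous g -> dual_norm g != 0 ->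
  dual_unit_sphere (normalized g).
Proof.
move=> gc N0; set N := dual_norm g in N0 *.
have {N0} N0 : 0 < N by rewrite lt_def N0 dual_norm_ge0.
have hE := normalizedE g; set h := normalized g in hE *; rewrite -/N in hE.
have h_le x : `|h x| <= 1 * `|x|.
  rewrite hE mul1r normrM normfV (gtr0_norm N0) ler_pdivrMl//.
  exact: ler_dual_norm.
have hc : continuous h := bounded_continuous h_le.
split => //; apply/eqP; rewrite eq_le; apply/andP; split.
  by apply: dual_norm_le => // x x1; rewrite (le_trans (h_le x))// mul1r.
rewrite -(ler_pM2l N0) mulr1.
apply: dual_norm_le; first by rewrite mulr_ge0 ?dual_norm_ge0// ltW.
move=> x x1; have -> : g x = N * h x by rewrite hE mulVKf// gt_eqF.
by rewrite normrM gtr0_norm// ler_pM2l// dual_norm_ub.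
Qed.

End dual_norm_theory.

(** * Alternative convexity or smoothness relative to a set of functionals *)

Section acs_at.
Context {R : realType} {X : completeNormedModType R}.
Implicit Types (K : set {linear X -> R}) (x : X).

(** The common generalisation of the two properties: K is the dual unit sphere
for sluacs and a singleton for luacs. *)
Definition acs_at K x := forall e : R, 0 < e -> exists2 d : R, 0 < d &
  forall y f, `|y| = 1 -> K f -> 2 - d < `|y + x| -> 1 - d < f y -> 1 - e < f x.

(** If no d works for some e, choosing a bad pair (y, f) for each d = 1/(n+1)
produces sequences that contradict the sequential hypothesis. *)
Lemma acs_at_seq K x : `|x| = 1 -> K `<=` dual_unit_sphere (X := X) ->
  (forall (y : nat -> X) (f : nat -> {linear X -> R}),
    (forall n, `|y n| = 1) -> (forall n, K (f n)) ->
    `|y n + x| @[n --> \oo] --> (2 : R) ->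
    f n (y n) @[n --> \oo] --> (1 : R) -> f n x @[n --> \oo] --> (1 : R)) ->
  acs_at K x.
Proof.
move=> x1 KS Kx e e0; apply: contrapT => nd.
have /choice[u uP] : forall n : nat, exists u : X * {linear X -> R},
    [/\ `|u.1| = 1, K u.2, 2 - n.+1%:R^-1 < `|u.1 + x|,
      1 - n.+1%:R^-1 < u.2 u.1 & u.2 x <= 1 - e].
  move=> n; apply: contrapT => nu; apply: nd.
  exists n.+1%:R^-1; first by rewrite invr_gt0.
  move=> y f y1 Kf yx fy; rewrite ltNge; apply/negP => fx; apply: nu.
  by exists (y, f).
have inv0 : n.+1%:R^-1 @[n --> \oo] --> (0 : R) by exact: cvg_harmonic.
have cvg_sub (c : R) : c - n.+1%:R^-1 @[n --> \oo] --> c.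
  rewrite -[X in _ --> X]subr0; apply: cvgB => //; exact: cvg_cst.
have KSu n : dual_unit_sphere (u n).2 by apply: KS; case: (uP n).
suff /cvgrPdist_lt/(_ e e0)[N _ /(_ N (leqnn N))] :
    (u n).2 x @[n --> \oo] --> (1 : R).
  by case: (uP N) => _ _ _ _ ux /(le_lt_trans (ler_norm _)) /=; lra.
apply: (Kx (fun n => (u n).1) (fun n => (u n).2)).
- by move=> n; case: (uP n).
- by move=> n; case: (uP n).
- apply: (squeeze_cvgr _ (cvg_sub 2) (cvg_cst _)); apply: nearW => n.
  case: (uP n) => y1 _ /ltW -> _ _ /=.
  by rewrite (le_trans (ler_normD _ _))// y1 x1.
- apply: (squeeze_cvgr _ (cvg_sub 1) (cvg_cst _)); apply: nearW => n.
  case: (uP n) => y1 _ _ /ltW -> _ /=.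
  have [fc f1] := KSu n; rewrite (le_trans (ler_norm _))// -f1 dual_norm_ub//.
  by rewrite y1.
Qed.

Lemma sluacs_acs_at K x : sluacs X -> `|x| = 1 ->
  K `<=` dual_unit_sphere (X := X) -> acs_at K x.
Proof.
move=> sX x1 KS; apply: acs_at_seq => // y f y1 Kf.
by apply: sX => // n; exact: KS.
Qed.

Lemma luacs_acs_at K x : luacs X -> `|x| = 1 ->
  K `<=` dual_unit_sphere (X := X) -> (forall f g, K f -> K g -> f =1 g) ->
  acs_at K x.
Proof.
move=> lX x1 KS K1; apply: acs_at_seq => // y f y1 Kf yx fy.
have fE n : f n =1 f 0%N by exact: K1.
have f0x : f 0%N x = 1.
  apply: (lX x y (f 0%N)) => //; first exact: KS.
  by under eq_fun => n do rewrite -(fE n).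
by under eq_fun => n do rewrite fE f0x; exact: cvg_cst.
Qed.

End acs_at.

Section acs_at_scaled.
Context {R : realType} {X : completeNormedModType R}.
Implicit Types (K : set {linear X -> R}) (x : X).

(** Homogeneous form, in which the functional and the vectors need not be
normalised. The norm of g may be arbitrarily small, so that normalising g could
amplify errors without bound; but then both terms of the conclusion are small
anyway, and it suffices to normalise when the norm of g exceeds a threshold
depending only on e and x. *)
Lemma acs_at_scaled K x : x != 0 -> acs_at K (`|x|^-1 *: x) ->
  forall e : R, 0 < e -> exists2 d : R, 0 < d &
    forall (y : X) (g : {linear X -> R}), continuous g -> dual_norm g <= 1 ->
      (dual_norm g != 0 -> K (normalized g)) ->
      `| `|y| - `|x| | < d -> 2 * `|x| - d < `|y + x| ->
      dual_norm g * `|y| - g y < d -> dual_norm g * `|x| - g x < e.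
Proof.
move=> x0 Kx e e0; set r := `|x|; have r0 : 0 < r by rewrite normr_gt0.
have [d d0 dP] := Kx _ (divr_gt0 e0 r0).
pose s := e / (4 * r); have s0 : 0 < s by rewrite divr_gt0// mulr_gt0.
have se : s * r = e / 4 by rewrite /s; field; rewrite gt_eqF.
have m1 : 0 < d * r / 2 by rewrite divr_gt0// mulr_gt0.
have m2 : 0 < d * (s * (r / 2)) by rewrite mulr_gt0// mulr_gt0// divr_gt0.
(* The three bounds keep |y| above r / 2, make |u + x / r| > 2 - d for the unit
   vector u = y / |y|, and make (normalized g) u > 1 - d. *)
exists (Num.min (r / 2) (Num.min (d * r / 2) (d * (s * (r / 2))))).
  by rewrite !lt_min m1 m2 divr_gt0.
move=> y g gc N1 KN; set N := dual_norm g in N1 KN *.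
rewrite ltr_distl; set m := Num.min _ _ => /andP[yr1 yr2] yx gy.
have [mr m1' m2'] : [/\ m <= r / 2, m <= d * r / 2 & m <= d * (s * (r / 2))].
  by rewrite /m !ge_min !lexx ?orbT; split.
have N0 : 0 <= N by exact: dual_norm_ge0.
(* s is chosen so that N < s makes |N * r| and |g x| at most e / 4 each. *)
have [Ns|sN] := ltP N s.
  have := ler_dual_norm x gc; rewrite ler_norml -/N -/r => /andP[gx _].
  have : N * r <= s * r by rewrite ler_wpM2r// ltW.
  lra.
have {}N0 : 0 < N by rewrite (lt_le_trans s0).
have y0 : 0 < `|y| by lra.
have Kg : K (normalized g) by apply: KN; rewrite gt_eqF.
have gE (c : R) z : normalized g (c *: z) = (N * c^-1)^-1 * g z.
  by rewrite normalizedE invfM invrK -mulrA; congr (_ * _); exact: linearZ.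
suff : 1 - e / r < normalized g (r^-1 *: x).
  rewrite gE invrK ltr_pdivlMl ?mulr_gt0// mulrBr mulr1.
  have -> : N * r * (e / r) = N * e by field; rewrite gt_eqF.
  have : N * e <= e by rewrite ler_piMl// ltW.
  lra.
apply: (dP (`|y|^-1 *: y)) => //.
- by rewrite normrZ normfV normr_id mulVf// gt_eqF.
- have -> : `|y|^-1 *: y + r^-1 *: x = r^-1 *: (y + x) - (r^-1 - `|y|^-1) *: y.
    by rewrite scalerDr scalerBl opprB [RHS]addrC addrA subrK.
  apply: lt_le_trans (lerB_dist _ _).
  rewrite !normrZ normfV normr_id.
  have -> : `|r^-1 - `|y|^-1| * `|y| = r^-1 * `| `|y| - r|.
    rewrite -[X in _ * X = _]normr_id.
    rewrite -[X in _ = X * _]ger0_norm ?invr_ge0 ?ltW//.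
    rewrite -!normrM; congr (`| _ |); field.
    by rewrite !gt_eqF.
  rewrite -mulrBr ltr_pdivlMl//.
  have : `| `|y| - r| < m by rewrite ltr_distl yr1.
  rewrite -/r; lra.
- rewrite gE invrK ltr_pdivlMl ?mulr_gt0// mulrBr mulr1.
  suff : m <= N * `|y| * d by lra.
  rewrite (le_trans m2')// mulrC; apply: ler_wpM2r; first exact: ltW.
  apply: ler_pM => //; [exact: ltW|by rewrite divr_ge0// ltW|].
  by rewrite -/r in yr1 *; lra.
Qed.

End acs_at_scaled.

(** * Property (P) and monotonicity in absolute spaces *)

Section property_P_quantitative.
Context {R : realType} {I : Type} (E : absolute_space R I).

Lemma property_P_at (a : E) (i : I) : property_P E -> `|a| = 1 ->
  forall e : R, 0 < e -> exists2 d : R, 0 < d &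
    forall b : E, `|b| = 1 -> 2 - d < `|b + a| -> `|a i - b i| < e.
Proof.
move=> PE a1 e e0; apply: contrapT => nd.
have /choice[u uP] : forall n : nat, exists b : E,
    [/\ `|b| = 1, 2 - n.+1%:R^-1 < `|b + a| & e <= `|a i - b i|].
  move=> n; apply: contrapT => nu; apply: nd.
  exists n.+1%:R^-1; first by rewrite invr_gt0.
  move=> b b1 ba; rewrite ltNge; apply/negP => eb; apply: nu.
  by exists b.
suff /cvgrPdist_lt/(_ e e0)[N _ /(_ N (leqnn N))] :
    u n i @[n --> \oo] --> a i.
  by rewrite /= ltNge; case: (uP N) => _ _ ->.
apply: (PE) => //.
- by move=> n; case: (uP n).
have cvg2 : 2 - n.+1%:R^-1 @[n --> \oo] --> (2 : R).
  rewrite -[X in _ --> X]subr0; apply: cvgB; first exact: cvg_cst.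
  exact: cvg_harmonic.
apply: (squeeze_cvgr _ cvg2 (cvg_cst _)); apply: nearW => n.
case: (uP n) => u1 /ltW -> _ /=.
by rewrite (le_trans (ler_normD _ _))// u1 a1.
Qed.

End property_P_quantitative.

Section absolute_space_extra.
Context {R : realType} {I : Type} (E : absolute_space R I).

Lemma as_val_normP (a : E) : as_set E (fun i => `|a i|).
Proof. by apply: (as_absolute (as_valP a) _).1 => i; rewrite normr_id. Qed.

Definition as_abs (a : E) : E := AsType (introT (as_memP E _) (as_val_normP a)).

Lemma as_norm_mono (a b : E) : (forall i, `|a i| <= `|b i|) -> `|a| <= `|b|.
Proof. by move=> ab; exact: (as_solid (as_valP b) ab).2. Qed.

Lemma norm_as_abs (a : E) : `|as_abs a| = `|a|.
Proof. by apply/eqP; rewrite eq_le !as_norm_mono// => i; rewrite normr_id. Qed.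

Lemma as_valD (a b : E) i : (a + b) i = a i + b i. Proof. by []. Qed.
Lemma as_valB (a b : E) i : (a - b) i = a i - b i. Proof. by []. Qed.
Lemma as_valZ k (a : E) i : (k *: a) i = k * a i. Proof. by []. Qed.

Lemma as_ext (a b : E) : (forall i, a i = b i) -> a = b.
Proof. by move=> ab; apply/val_inj/funext. Qed.

End absolute_space_extra.

(** * The modulus of a functional on the sum *)

Section modulus.
Context {R : realType} {I : Type} (E : absolute_space R I).
Variable X : I -> completeNormedModType R.
Local Notation Y := (absolute_sum E X).
Implicit Types (f : {linear Y -> R}) (b c : E) (x y z : Y).

Definition norms y : E := AsType (introT (as_memP E _) (sum_valP y)).

Lemma normsE y i : norms y i = `|y i|. Proof. by []. Qed.

Lemma norms_ge0 y i : 0 <= norms y i.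
Proof. exact: normr_ge0. Qed.

Lemma norm_norms y : `|norms y| = `|y|. Proof. by []. Qed.

Lemma sum_valD y z i : (y + z) i = y i + z i. Proof. by []. Qed.
Lemma sum_valN y i : (- y) i = - y i. Proof. by []. Qed.
Lemma sum_valZ k y i : (k *: y) i = k *: y i. Proof. by []. Qed.
Lemma sum_val0 i : (0 : Y) i = 0. Proof. by []. Qed.

Definition dominated b : set Y := [set y | forall i, `|y i| <= b i].

Lemma dominated_norm b y : dominated b y -> `|y| <= `|b|.
Proof.
move=> yb; apply: (@as_norm_mono _ _ E (norms y)) => i.
by rewrite normsE normr_id (le_trans (yb i))// ler_norm.
Qed.

Lemma dominated_norms y : dominated (norms y) y.
Proof. by move=> i; exact: lexx. Qed.

Lemma sum_of_dominated b (u : forall i, X i) : (forall i, `|u i| <= b i) ->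
  exists y : Y, forall i, y i = u i.
Proof.
move=> ub.
have uE : as_set E (fun i => `|u i|).
  apply: (as_solid (as_valP b) _).1 => i.
  by rewrite normr_id (le_trans (ub i))// ler_norm.
by exists (AbsoluteSum uE).
Qed.

(** Meaningful only for nonnegative b; when finitely supported vectors are
dense and f is continuous, it is then sum_i |f_i| b_i, where f_i is the
restriction of f to the i-th summand. *)
Definition modulus f b : R := sup [set f y | y in dominated b].

Section modulus_theory.
Variables (f : {linear Y -> R}) (fc : continuous f).
Local Notation P := (modulus f).

Lemma modulus_ub b y : dominated b y -> f y <= P b.
Proof.
move=> yb; apply: ub_le_sup; last by exists y.
exists (dual_norm f * `|b|) => _ [z zb <-].
rewrite (le_trans (ler_norm _))// (le_trans (ler_dual_norm _ fc))//.
by rewrite ler_wpM2l ?dual_norm_ge0// dominated_norm.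
Qed.

Lemma modulus_le b r : (forall i, 0 <= b i) ->
  (forall y, dominated b y -> f y <= r) -> P b <= r.
Proof.
move=> b0 br; apply: ge_sup; last by move=> _ [z zb <-]; exact: br.
by exists (f 0), 0 => // i; rewrite sum_val0 normr0.
Qed.

Lemma modulus_ge0 b : (forall i, 0 <= b i) -> 0 <= P b.
Proof.
move=> b0; rewrite -(linear0 f); apply: modulus_ub => i.
by rewrite sum_val0 normr0.
Qed.

Lemma modulus_norm b : (forall i, 0 <= b i) -> P b <= dual_norm f * `|b|.
Proof.
move=> b0; apply: modulus_le => // y yb.
rewrite (le_trans (ler_norm _))// (le_trans (ler_dual_norm _ fc))//.
by rewrite ler_wpM2l ?dual_norm_ge0// dominated_norm.
Qed.

Lemma modulus_mono b c : (forall i, 0 <= b i) -> (forall i, b i <= c i) ->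
  P b <= P c.
Proof.
move=> b0 bc; apply: modulus_le => // y yb; apply: modulus_ub => i.
by rewrite (le_trans (yb i)).
Qed.

(** Riesz decomposition: a vector dominated by b + c is a sum of vectors
dominated by b and by c, obtained by splitting each coordinate in the ratio
b_i : c_i. *)
Lemma modulusD b c : (forall i, 0 <= b i) -> (forall i, 0 <= c i) ->
  P (b + c) = P b + P c.
Proof.
move=> b0 c0; have bc0 i : 0 <= (b + c) i by rewrite as_valD addr_ge0.
apply/eqP; rewrite eq_le; apply/andP; split.
  apply: modulus_le => // z zbc.
  pose t i := b i / (b i + c i).
  have tP i : [/\ 0 <= t i, 0 <= 1 - t i, t i * `|z i| <= b i &
      (1 - t i) * `|z i| <= c i].
    have zi := zbc i; rewrite as_valD in zi.
    have := b0 i; have := c0 i; rewrite /t => ci bi.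
    (* If b i + c i = 0, then t i = 0 as 1 / 0 = 0 by convention, and z i = 0. *)
    have [bc|bc] := eqVneq (b i + c i) 0.
      by rewrite bc invr0 mulr0 subr0 mul0r mul1r; split => //; lra.
    have s0 : 0 < b i + c i by rewrite lt_def bc addr_ge0.
    have -> : 1 - b i / (b i + c i) = c i / (b i + c i) by field.
    rewrite !divr_ge0 ?addr_ge0// ![_ / _ * _]mulrAC !ler_pdivrMr//.
    by rewrite !ler_wpM2l.
  have [y yE] : exists y : Y, forall i, y i = t i *: z i.
    apply: (@sum_of_dominated b) => i; have [t0 _ tz _] := tP i.
    by rewrite normrZ ger0_norm.
  have -> : z = y + (z - y) by rewrite addrC subrK.
  rewrite linearD lerD//; apply: modulus_ub => i; have [t0 t1 tz tz1] := tP i.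
    by rewrite yE normrZ ger0_norm.
  rewrite sum_valD sum_valN yE -[X in X - _]scale1r -scalerBl.
  by rewrite normrZ ger0_norm.
rewrite -lerBrDr; apply: modulus_le => // y yb.
rewrite lerBrDr addrC -lerBrDr; apply: modulus_le => // z zc.
rewrite lerBrDr -linearD; apply: modulus_ub => i.
by rewrite sum_valD as_valD (le_trans (ler_normD _ _))// [leRHS]addrC lerD.
Qed.

Lemma modulus0 : P 0 = 0.
Proof.
apply/eqP; rewrite eq_le modulus_ge0 ?andbT//.
by rewrite (le_trans (modulus_norm _))// normr0 mulr0.
Qed.

Lemma modulusZ k b : 0 <= k -> (forall i, 0 <= b i) -> P (k *: b) = k * P b.
Proof.
move=> k0 b0; have [->|kN0] := eqVneq k 0.
  by rewrite scale0r mul0r modulus0.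
have {kN0} k0 : 0 < k by rewrite lt_def kN0.
have le_scale (l : R) (d : E) : 0 < l -> (forall i, 0 <= d i) ->
    l * P d <= P (l *: d).
  move=> l0 d0; rewrite -ler_pdivlMl//; apply: modulus_le => // y yd.
  rewrite ler_pdivlMl//.
  have -> : l * f y = f (l *: y) by rewrite linearZ.
  apply: modulus_ub => i.
  rewrite sum_valZ as_valZ normrZ gtr0_norm//.
  by apply: ler_wpM2l; [exact: ltW|exact: yd].
apply/eqP; rewrite eq_le le_scale// andbT -ler_pdivrMl//.
rewrite (le_trans (le_scale _ _ _ _)) ?invr_gt0//.
  by move=> i; rewrite as_valZ mulr_ge0// ltW.
by rewrite scalerA mulVf ?gt_eqF// scale1r.
Qed.

(** An additive, positively homogeneous function on the positive cone extends
linearly. Writing phi b = P (b + |b|) - P |b| only uses P on the cone, and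
additivity allows any c >= 0 with b + c >= 0 in the place of |b|, which is what
makes phi linear. The norm of phi is that of f because
f z <= P (|z_i|)_i while |phi b| <= P |b|. *)
Lemma modulus_linear : exists phi : {linear E -> R},
  [/\ forall b, (forall i, 0 <= b i) -> phi b = P b, continuous phi &
    dual_norm phi = dual_norm f].
Proof.
have abs0 (b : E) i : 0 <= as_abs b i by exact: normr_ge0.
have babs (b : E) i : 0 <= (b + as_abs b) i.
  rewrite as_valD -lerBlDr sub0r lerNl.
  by have := ler_norm (- b i); rewrite normrN.
pose phi b := P (b + as_abs b) - P (as_abs b).
have shift b c : (forall i, 0 <= c i) -> (forall i, 0 <= (b + c) i) ->
    phi b = P (b + c) - P c.
  move=> c0 bc0; apply/eqP; rewrite /phi subr_eq addrAC eq_sym subr_eq.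
  by rewrite -!modulusD// addrAC -addrA.
have phiZ k b : phi (k *: b) = k * phi b.
  have [k0|k0] := leP 0 k.
    rewrite (shift _ (k *: as_abs b)) -?scalerDr ?modulusZ -?mulrBr//.
      by move=> i; rewrite as_valZ mulr_ge0.
    by move=> i; rewrite as_valZ mulr_ge0.
  have k0' : 0 <= - k by rewrite oppr_ge0 ltW.
  have absb i : 0 <= (as_abs b - b) i by rewrite as_valB subr_ge0 ler_norm.
  have kE : k *: b + - k *: as_abs b = - k *: (as_abs b - b).
    by rewrite scalerBr scaleNr scaleNr opprK addrC.
  rewrite (shift _ (- k *: as_abs b)) ?kE.
  - rewrite !modulusZ// -mulrBr !mulNr -mulrN; congr (_ * _).
    have : P (as_abs b - b) + P (b + as_abs b) = P (as_abs b) + P (as_abs b).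
      by rewrite -!modulusD// addrA subrK.
    rewrite /phi; lra.
  - by move=> i; rewrite as_valZ mulr_ge0.
  - by move=> i; rewrite as_valZ mulr_ge0.
have phiD b c : phi (b + c) = phi b + phi c.
  rewrite (shift _ (as_abs b + as_abs c)).
    rewrite addrACA modulusD// modulusD// /phi.
    by rewrite opprD addrACA.
  - by move=> i; rewrite as_valD addr_ge0.
  - by move=> i; rewrite addrACA as_valD addr_ge0.
have phiL : linear_for *:%R phi by move=> k b c; rewrite phiD phiZ.
pose phil : {linear E -> R} :=
  HB.pack phi (GRing.isLinear.Build R E R *:%R phi phiL).
have phiP b : (forall i, 0 <= b i) -> phil b = P b.
  by move=> b0; rewrite /= (shift _ 0) ?addr0 ?modulus0 ?subr0.
have phi_le b : `|phil b| <= dual_norm f * `|b|.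
  have phi_le1 d : phil d <= P (as_abs d).
    rewrite -phiP// -subr_ge0 -linearB phiP ?modulus_ge0// => i;
    by rewrite as_valB subr_ge0 ler_norm.
  rewrite -norm_as_abs (le_trans _ (modulus_norm _))// ler_norml phi_le1 andbT.
  rewrite lerNl -linearN (le_trans (phi_le1 _))//.
  rewrite (_ : as_abs (- b) = as_abs b)//.
  by apply: as_ext => i; exact: normrN.
have phic : continuous phil by exact: bounded_continuous phi_le.
exists phil; split => //; apply/eqP; rewrite eq_le; apply/andP; split.
  apply: dual_norm_le; first exact: dual_norm_ge0.
  move=> b b1; rewrite (le_trans (phi_le _))//.
  by rewrite -[leRHS]mulr1 ler_wpM2l// dual_norm_ge0.
apply: dual_norm_le; first exact: dual_norm_ge0.
move=> y y1; have fy z : `|z| <= 1 -> f z <= dual_norm phil.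
  move=> z1; rewrite (le_trans (modulus_ub (dominated_norms z)))//.
  rewrite -phiP; last exact: norms_ge0.
  by rewrite (le_trans (ler_norm _))// dual_norm_ub.
by rewrite ler_norml fy// andbT lerNl -linearN fy// normrN.
Qed.

End modulus_theory.

End modulus.

(** * Single coordinates and truncations *)

Section coordinates.
Context {R : realType} {I : Type} (E : absolute_space R I).
Variable X : I -> completeNormedModType R.
Local Notation Y := (absolute_sum E X).

Lemma as_unitE i j : as_unit E i j = \1_[set i] j. Proof. by []. Qed.

(** As I is an arbitrary type, v : X i is transported to X j along a
classically decided equality. *)
Definition single_val i (v : X i) j : X j :=
  if pselect (i = j) is left e then eq_rect i X v j e else 0.

Lemma single_val_self i (v : X i) : single_val v i = v.
Proof.
rewrite /single_val; case: pselect => // e.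
by rewrite (Prop_irrelevance e erefl).
Qed.

Lemma single_val_neq i (v : X i) j : i <> j -> single_val v j = 0.
Proof. by rewrite /single_val; case: pselect. Qed.

Lemma single_subproof i (v : X i) : as_set E (fun j => `|single_val v j|).
Proof.
apply: (as_solid (as_valP (`|v| *: as_unit E i)) _).1 => j.
rewrite normr_id as_valZ as_unitE indicE.
have [<-|ij] := pselect (i = j).
  by rewrite single_val_self mem_set// mulr1 normr_id.
by rewrite single_val_neq// normr0.
Qed.

Definition single i (v : X i) : Y := AbsoluteSum (single_subproof v).

Lemma single_self i (v : X i) : single v i = v.
Proof. exact: single_val_self. Qed.

Lemma single_neq i (v : X i) j : i <> j -> single v j = 0.
Proof. exact: single_val_neq. Qed.

Lemma single_linear i : linear (@single i).
Proof.
move=> k u v; apply: absolute_sum_eq => j; rewrite sum_valD sum_valZ.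
have [<-|ij] := pselect (i = j); first by rewrite !single_self.
by rewrite !single_neq// scaler0 addr0.
Qed.

HB.instance Definition _ i :=
  GRing.isLinear.Build R (X i) Y *:%R (@single i) (@single_linear i).

Lemma norm_single i (v : X i) : `|single v| = `|v|.
Proof.
apply/eqP; rewrite eq_le; apply/andP; split.
  have -> : `|v| = `| `|v| *: as_unit E i|.
    by rewrite normrZ normr_id as_normE /= as_normalised mulr1.
  apply: (@as_norm_mono _ _ E (norms (single v))) => j.
  rewrite normsE normr_id as_valZ as_unitE indicE.
  have [<-|ij] := pselect (i = j).
    by rewrite single_self mem_set// mulr1 normr_id.
  by rewrite single_neq// normr0.
by rewrite -{1}(single_self v) sum_coord_le.
Qed.

Definition restrict_val (A : set I) (y : Y) i : X i :=
  if pselect (A i) then y i else 0.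

Lemma restrict_subproof A y : as_set E (fun i => `|restrict_val A y i|).
Proof.
have le_y i : `| `|restrict_val A y i| | <= `| `|y i| |.
  by rewrite !normr_id /restrict_val; destruct (pselect (A i)); rewrite ?normr0.
exact: (as_solid (sum_valP y) le_y).1.
Qed.

Definition sum_restrict A y : Y := AbsoluteSum (restrict_subproof A y).

Lemma restrict_in A y i : A i -> sum_restrict A y i = y i.
Proof. by rewrite /sum_restrict /= /restrict_val; case: pselect. Qed.

Lemma restrict_notin A y i : ~ A i -> sum_restrict A y i = 0.
Proof. by rewrite /sum_restrict /= /restrict_val; case: pselect. Qed.

Lemma restrict0 y : sum_restrict set0 y = 0.
Proof. by apply: absolute_sum_eq => i; rewrite restrict_notin. Qed.

Lemma restrict_add_single A y i : ~ A i ->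
  sum_restrict (i |` A) y = sum_restrict A y + single (y i).
Proof.
move=> Ai; apply: absolute_sum_eq => j; rewrite sum_valD.
have [<-|ij] := pselect (i = j).
  rewrite single_self restrict_in; last by left.
  by rewrite restrict_notin// add0r.
rewrite single_neq// addr0; have [Aj|Aj] := pselect (A j).
  by rewrite !restrict_in//; right.
by rewrite !restrict_notin// => -[/esym|].
Qed.

(** If a finite combination c of unit vectors approximates (|y_i|)_i, then
removing from y the coordinates in the support of c leaves a vector dominated
by |(|y_i|)_i - c|. *)
Lemma dense_restrict (y : Y) (e : R) : dense (finite_span E) -> 0 < e ->
  exists s : seq I, `|y - sum_restrict [set i | List.In i s] y| < e.
Proof.
move=> dE e0.
have [] := dE (ball (norms y) e).
- by exists (norms y); exact: ballxx.
- exact: ball_open.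
move=> a [+ [s [c aE]]]; rewrite -ball_normE /= => ya.
exists s; apply: le_lt_trans ya.
apply: (@as_norm_mono _ _ E (norms (y - _))) => i.
rewrite normsE normr_id sum_valD sum_valN.
have [si|si] := pselect (List.In i s).
  by rewrite restrict_in// subrr normr0.
rewrite restrict_notin// subr0.
suff ai : a i = 0 by rewrite as_valB ai subr0 normsE normr_id.
rewrite aE; elim: s si {aE} => [|j s IH] si; first by rewrite big_nil.
rewrite big_cons as_valD IH ?addr0; last by move=> si'; apply: si; right.
rewrite as_valZ as_unitE indicE memNset ?mulr0// => ij; apply: si; left.
by rewrite ij.
Qed.

End coordinates.

(** * The gap between a functional and its modulus *)

Section gap.
Context {R : realType} {I : Type} (E : absolute_space R I).
Variable X : I -> completeNormedModType R.
Local Notation Y := (absolute_sum E X).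
Variables (f : {linear Y -> R}) (fc : continuous f).

Definition coordinate i : {linear X i -> R} := f \o @single _ _ E X i.

Lemma coordinateE i v : coordinate i v = f (single E v).
Proof. by []. Qed.

Lemma coordinate_bound i (v : X i) : `|coordinate i v| <= dual_norm f * `|v|.
Proof. by rewrite -(norm_single E v) coordinateE ler_dual_norm. Qed.

Lemma coordinate_continuous i : continuous (coordinate i).
Proof. exact: bounded_continuous (@coordinate_bound i). Qed.

Lemma dual_norm_coordinate_le i : dual_norm (coordinate i) <= dual_norm f.
Proof.
apply: dual_norm_le; first exact: dual_norm_ge0.
move=> v v1; rewrite (le_trans (coordinate_bound v))//.
by rewrite -[leRHS]mulr1 ler_wpM2l// dual_norm_ge0.
Qed.

(** A vector dominated by the norms of [single E v] is supported at i. *)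
Lemma modulus_single i (v : X i) :
  modulus f (norms (single E v)) = dual_norm (coordinate i) * `|v|.
Proof.
apply/eqP; rewrite eq_le; apply/andP; split.
  apply: modulus_le => //; first exact: norms_ge0.
  move=> y yv.
  have -> : y = single E (y i).
    apply: absolute_sum_eq => j; have [<-|ij] := pselect (i = j).
      by rewrite single_self.
    rewrite single_neq//; apply/eqP; rewrite -normr_le0.
    by have := yv j; rewrite normsE single_neq// normr0.
  rewrite -coordinateE (le_trans (ler_norm _))//.
  rewrite (le_trans (ler_dual_norm _ (@coordinate_continuous i)))//.
  rewrite ler_wpM2l ?dual_norm_ge0//; first exact: coordinate_continuous.
  by have := yv i; rewrite normsE single_self.
have [->|v0] := eqVneq v 0.
  by rewrite normr0 mulr0 modulus_ge0//; exact: norms_ge0.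
have nv0 : 0 < `|v| by rewrite normr_gt0.
rewrite -ler_pdivlMr//; apply: dual_norm_le.
  by rewrite divr_ge0// modulus_ge0//; exact: norms_ge0.
have main (w : X i) : `|w| <= 1 ->
    coordinate i w <= modulus f (norms (single E v)) / `|v|.
  move=> w1; rewrite ler_pdivlMr// mulrC.
  have -> : `|v| * coordinate i w = f (single E (`|v| *: w)).
    by rewrite -coordinateE linearZ.
  apply: modulus_ub => // j; rewrite normsE.
  have [<-|ij] := pselect (i = j); last by rewrite !single_neq// normr0.
  by rewrite !single_self normrZ normr_id ler_piMr.
by move=> w w1; rewrite ler_norml main// andbT lerNl -linearN main// normrN.
Qed.

(** Unlike f itself, the gap is nonnegative and subadditive, so it can be
estimated one coordinate at a time. *)
Definition gap (y : Y) := modulus f (norms y) - f y.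

Lemma gap_ge0 y : 0 <= gap y.
Proof. by rewrite subr_ge0 modulus_ub//; exact: dominated_norms. Qed.

Lemma gap0 : gap 0 = 0.
Proof.
rewrite /gap linear0 subr0 (_ : norms 0 = 0) ?modulus0//.
by apply: as_ext => i; rewrite normsE sum_val0 normr0.
Qed.

Lemma gapD y z : gap (y + z) <= gap y + gap z.
Proof.
rewrite /gap linearD [leRHS]addrACA -opprD lerD2r -modulusD//;
  try exact: norms_ge0.
apply: modulus_mono => // i; first exact: norms_ge0.
by rewrite as_valD !normsE ler_normD.
Qed.

Lemma gap_le y : gap y <= 2 * dual_norm f * `|y|.
Proof.
have := modulus_norm fc (@norms_ge0 _ _ _ _ y); rewrite norm_norms.
have := ler_dual_norm y fc; rewrite ler_norml /gap => /andP[+ _].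
lra.
Qed.

Lemma gap_single i (v : X i) :
  gap (single E v) = dual_norm (coordinate i) * `|v| - coordinate i v.
Proof. by rewrite /gap modulus_single. Qed.

(** The gap is additive over the disjoint supports of [single E (y i)] and of
the rest of y, and both parts are nonnegative. *)
Lemma gap_coordinate (y : Y) i : gap (single E (y i)) <= gap y.
Proof.
pose z := y - single E (y i).
have -> : gap y = gap (single E (y i)) + gap z.
  rewrite /gap addrACA -opprD -linearD -modulusD//; try exact: norms_ge0.
  congr (modulus f _ - f _); last by rewrite /z addrC subrK.
  apply: as_ext => j; rewrite as_valD !normsE /z sum_valD sum_valN.
  have [<-|ij] := pselect (i = j).
    by rewrite single_self subrr normr0 addr0.
  by rewrite single_neq// subr0 normr0 add0r.
by rewrite lerDl gap_ge0.
Qed.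

Lemma gap_restrict_add A (y : Y) i :
  gap (sum_restrict (i |` A) y) <=
  gap (sum_restrict A y) + gap (single E (y i)).
Proof.
have [Ai|Ai] := pselect (A i); last by rewrite restrict_add_single// gapD.
have -> : i |` A = A.
  by apply/seteqP; split => [j [->|]|j Aj]//; right.
by rewrite lerDl gap_ge0.
Qed.

End gap.

(** * Gluing the coordinates *)

Section main.
Context {R : realType} {I : Type} (E : absolute_space R I).
Variable X : I -> completeNormedModType R.
Local Notation Y := (absolute_sum E X).

Lemma norms_add (x y : Y) : `|y + x| <= `|norms y + norms x|.
Proof.
apply: (@as_norm_mono _ _ E (norms (y + x)) (norms y + norms x)) => i.
rewrite as_valD !normsE normr_id sum_valD (le_trans (ler_normD _ _))//.
exact: ler_norm.
Qed.

(** Let a be (|x_j|)_j with the i-th coordinate lowered by t. If |x_n i + x i|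
were at most 2 |x i| - e, then |x_n + x| <= |norms x_n + a|, because |x_n i| is
close to |x i|. As |x_n + x| -> 2, a would have norm 1, and property (P) at a
would bring |x_n i| close to |x i| - t instead of |x i|. *)
Lemma coord_sum_near (x : Y) (x_ : nat -> Y) (i : I) : property_P E ->
  `|x| = 1 -> (forall n, `|x_ n| = 1) -> x i != 0 ->
  `|x_ n + x| @[n --> \oo] --> (2 : R) -> `|x_ n i| @[n --> \oo] --> `|x i| ->
  forall e : R, 0 < e -> \forall n \near \oo, 2 * `|x i| - e < `|x_ n i + x i|.
Proof.
move=> PE x1 xn1 xi0 xnx xni e e0; have r0 : 0 < `|x i| by rewrite normr_gt0.
(* t <= e / 2 leaves room for |x_n i| to differ from |x i| by t. *)
pose t := Num.min `|x i| (e / 2); have t0 : 0 < t by rewrite lt_min r0 divr_gt0.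
have [tr te] : t <= `|x i| /\ t <= e / 2 by rewrite /t !ge_min !lexx ?orbT.
pose a := norms x - t *: as_unit E i.
have ai : a i = `|x i| - t.
  by rewrite as_valB as_valZ as_unitE indicE mem_set// mulr1.
have aj j : i <> j -> a j = `|x j|.
  move=> ij; rewrite as_valB as_valZ as_unitE indicE.
  by rewrite memNset ?mulr0 ?subr0// => /esym.
have a1 : `|a| <= 1.
  rewrite -x1 -norm_norms; apply: as_norm_mono => j; rewrite [leRHS]normr_id.
  have [<-|ij] := pselect (i = j); last by rewrite aj// normr_id.
  by rewrite ai ger0_norm ?subr_ge0//; lra.
(* When |a| < 1 the premise on |b + a| fails for a suitable d. *)
have [d d0 dP] : exists2 d : R, 0 < d & forall b : E, `|b| = 1 ->
    2 - d < `|b + a| -> `|a i - b i| < t / 2.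
  move: a1; rewrite le_eqVlt => /orP[/eqP a1|a1].
    by apply: property_P_at => //; rewrite divr_gt0.
  exists (1 - `|a|); first by rewrite subr_gt0.
  by move=> b b1 ba; have := ler_normD b a; lra.
have /cvgrPdist_lt/(_ (t / 2)) := xni; rewrite divr_gt0// => /(_ erefl) near1.
have /cvgrPdist_lt/(_ d d0) near2 := xnx.
near=> n; rewrite ltNge; apply/negP => xnxi.
have n1 : `| `|x i| - `|x_ n i| | < t / 2 by near: n.
have n2 : `|2 - `|x_ n + x| | < d by near: n.
have := dP (norms (x_ n)) (xn1 n).
rewrite ai normsE => H.
suff /H : 2 - d < `|norms (x_ n) + a|.
  by move: n1; rewrite !ltr_norml => /andP[? ?] /andP[? ?]; lra.
suff : `|x_ n + x| <= `|norms (x_ n) + a|.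
  by move: n2; rewrite ltr_norml => /andP[? ?] ?; lra.
apply: (@as_norm_mono _ _ E (norms (x_ n + x)) (norms (x_ n) + a)) => j.
rewrite as_valD !normsE normr_id sum_valD.
have [<-|ij] := pselect (i = j); last first.
  by rewrite aj// (le_trans (ler_normD _ _))// ler_norm.
rewrite ai (le_trans xnxi)// (le_trans _ (ler_norm _))//.
by move: n1; rewrite ltr_norml => /andP[? ?]; lra.
Unshelve. all: by end_near. Qed.

(** The common core of the two cases: [phi_ n] extends the modulus of [f_ n],
and the two hypotheses on [acs_at] involve only the functionals that arise from
the sequence [f_], which are all equal when [f_] is constant. *)
Lemma sum_acs_seq (x : Y) (x_ : nat -> Y) (f_ : nat -> {linear Y -> R})
    (phi_ : nat -> {linear E -> R}) : dense (finite_span E) -> property_P E ->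
  `|x| = 1 -> (forall n, `|x_ n| = 1) -> (forall n, dual_unit_sphere (f_ n)) ->
  (forall n (b : E), (forall i, 0 <= b i) -> phi_ n b = modulus (f_ n) b) ->
  acs_at (range phi_) (norms x) ->
  (forall i, x i != 0 -> acs_at
     [set normalized (coordinate (f_ n) i) |
       n in [set n | dual_norm (coordinate (f_ n) i) != 0]]
     (`|x i|^-1 *: x i)) ->
  `|x_ n + x| @[n --> \oo] --> (2 : R) ->
  f_ n (x_ n) @[n --> \oo] --> (1 : R) ->
  f_ n x @[n --> \oo] --> (1 : R).
Proof.
move=> dE PE x1 xn1 fn1 phiE aE aX xnx fnx.
have fc n : continuous (f_ n) by case: (fn1 n).
have fN n : dual_norm (f_ n) = 1 by case: (fn1 n).
have f_le n (y : Y) : f_ n y <= `|y|.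
  have := ler_dual_norm y (fc n); rewrite fN mul1r.
  by apply: le_trans; exact: ler_norm.
have mod_le n (y : Y) : modulus (f_ n) (norms y) <= `|y|.
  by have := modulus_norm (fc n) (@norms_ge0 _ _ _ _ y); rewrite fN mul1r.
have abs2 : `|norms (x_ n) + norms x| @[n --> \oo] --> (2 : R).
  apply: (squeeze_cvgr _ xnx (cvg_cst _)); apply: nearW => n.
  rewrite norms_add /=.
  by rewrite (le_trans (ler_normD _ _))// !norm_norms x1 xn1.
have coord i : `|x_ n i| @[n --> \oo] --> `|x i|.
  exact: (PE (fun n => norms (x_ n)) (norms x) xn1 x1 abs2).
have gap_xn : forall e : R, 0 < e -> \forall n \near \oo, gap (f_ n) (x_ n) < e.
  move=> e e0; have /cvgrPdist_lt/(_ e e0) := fnx; apply: filterS => n.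
  rewrite /gap => /(le_lt_trans (ler_norm _)).
  by have := mod_le n (x_ n); rewrite xn1; lra.
have phi_x : forall e : R, 0 < e ->
    \forall n \near \oo, 1 - e < modulus (f_ n) (norms x).
  move=> e e0; have [d d0 dP] := aE e e0.
  have /cvgrPdist_lt/(_ d d0) near1 := abs2.
  have /cvgrPdist_lt/(_ d d0) near2 := fnx.
  near=> n; rewrite -phiE; last exact: norms_ge0.
  apply: (dP (norms (x_ n))) => //.
  - exact: xn1.
  - have : `|2 - `|norms (x_ n) + norms x| | < d by near: n.
    by move=> /(le_lt_trans (ler_norm _)); lra.
  - rewrite phiE; last exact: norms_ge0.
    have : `|1 - f_ n (x_ n)| < d by near: n.
    move=> /(le_lt_trans (ler_norm _)).
    have := modulus_ub (fc n) (@dominated_norms _ _ _ _ (x_ n)); lra.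
have gap_coord i : forall e : R, 0 < e ->
    \forall n \near \oo, gap (f_ n) (single E (x i)) < e.
  move=> e e0; have [->|xi0] := eqVneq (x i) 0.
    by apply: nearW => n; rewrite linear0 gap0.
  have [d d0 dP] := acs_at_scaled xi0 (aX i xi0) e0.
  have /cvgrPdist_lt/(_ d d0) near1 := coord i.
  have near2 := coord_sum_near PE x1 xn1 xi0 xnx (coord i) d0.
  have near3 := gap_xn _ d0.
  near=> n; rewrite gap_single//; apply: (dP (x_ n i)).
  - exact: coordinate_continuous.
  - by rewrite -(fN n) dual_norm_coordinate_le.
  - by move=> N0; exists n.
  - by rewrite distrC; near: n.
  - by near: n.
  - rewrite -gap_single// (le_lt_trans (gap_coordinate _ _ _))//.
    by near: n.
have gap_restrict (s : seq I) : forall e : R, 0 < e ->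
    \forall n \near \oo, gap (f_ n) (sum_restrict [set i | List.In i s] x) < e.
  elim: s => [|i s IH] e e0.
    by apply: nearW => n; rewrite (_ : [set _ | _] = set0)// restrict0 gap0.
  have e20 : 0 < e / 2 by rewrite divr_gt0.
  have near1 := IH _ e20; have near2 := gap_coord i _ e20.
  near=> n.
  have -> : [set j | List.In j (i :: s)] = i |` [set j | List.In j s].
    by apply/seteqP; split => j /= [->|?]; [left|right|left|right].
  apply: le_lt_trans (gap_restrict_add (fc n) _ _ _) _.
  by rewrite (splitr e) ltrD//; near: n.
apply/cvgrPdist_lt => e e0; have e40 : 0 < e / 4 by rewrite divr_gt0.
have [s sP] := dense_restrict x dE e40.
have near1 := gap_restrict s _ e40; have near2 := phi_x _ e40.
near=> n.
have fnx1 : f_ n x <= 1 by rewrite -x1 f_le.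
rewrite ger0_norm ?subr_ge0//.
have : gap (f_ n) x < 3 * (e / 4).
  set y := sum_restrict _ x in sP *; rewrite -(subrK y x).
  apply: le_lt_trans (gapD (fc n) _ _) _.
  have := gap_le (fc n) (x - y); rewrite fN.
  have : gap (f_ n) y < e / 4 by near: n.
  by move: sP; lra.
have : 1 - e / 4 < modulus (f_ n) (norms x) by near: n.
rewrite /gap; lra.
Unshelve. all: by end_near. Qed.

End main.

Theorem proposition3p5 (R : realType) (I : Type) (hI : inhabited I)
    (E : absolute_space R I) (dE : dense (finite_span E))
    (X : I -> completeNormedModType R) :
  ((forall i, sluacs (X i)) -> sluacs E -> property_P E ->
    sluacs (absolute_sum E X)) /\
  ((forall i, luacs (X i)) -> luacs E -> property_P E ->
    luacs (absolute_sum E X)).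
Proof.
have coord_sphere (f : {linear absolute_sum E X -> R}) i : continuous f ->
    dual_norm (coordinate f i) != 0 ->
    dual_unit_sphere (normalized (coordinate f i)).
  move=> fc; apply: dual_unit_sphere_normalized.
  exact: coordinate_continuous.
have unitE i (x : X i) : x != 0 -> `| `|x|^-1 *: x| = 1.
  by move=> x0; rewrite normrZ normfV normr_id mulVf// normr_eq0.
split => [sX sE PE x x_ f_ x1 xn1 fn1 xnx fnx|
          lX lE PE x x_ f x1 xn1 [fc fN] xnx fnx].
  have fc n : continuous (f_ n) by case: (fn1 n).
  have /choice[phi_ phiP] n := modulus_linear (fc n).
  apply: (sum_acs_seq (phi_ := phi_) dE PE x1 xn1 fn1 _ _ _ xnx fnx).
  - by move=> n; case: (phiP n).
  - apply: sluacs_acs_at => // _ [n _ <-]; have [_ phic phiN] := phiP n.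
    by split => //; rewrite phiN; case: (fn1 n).
  - move=> i xi0; apply: sluacs_acs_at => //; first exact: unitE.
    by move=> _ [n n0 <-]; exact: coord_sphere.
have [phi [phiE phic phiN]] := modulus_linear fc.
have fx1 : (fun=> f x) @ \oo --> (1 : R).
  apply: (sum_acs_seq (f_ := fun=> f) (phi_ := fun=> phi) dE PE x1 xn1
    _ _ _ _ xnx fnx) => //.
  - apply: luacs_acs_at => //.
      by move=> _ [_ _ <-]; split => //; rewrite phiN.
    by move=> _ _ [_ _ <-] [_ _ <-].
  - move=> i xi0; apply: luacs_acs_at => //; first exact: unitE.
      by move=> _ [n n0 <-]; exact: coord_sphere.
    by move=> _ _ [_ _ <-] [_ _ <-].
exact: (cvg_unique _ (cvg_cst _) fx1).
Qed.
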